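(* Let $W_0=\mathbb{C}[e_{-1},e_{-2},e_{-3},\dots]\,|0\rangle\subset L_{(0,1)}$ be the basic subspace. Then its character $\operatorname{ch}W_0=\operatorname{Tr}_{W_0}\left(z^{h_0/2}q^{L_0}\right)$ equals $$\operatorname{ch}W_0=\sum_{n=0}^{\infty}\frac{z^n\,q^{n^2}}{(q)_n}.$$
   Context: The Lie algebra $\widehat{\mathfrak{sl}}_2'=\mathfrak{sl}_2\otimes\mathbb{C}[t,t^{-1}]\oplus\mathbb{C}K$ has basis $e_n,f_n,h_n$ ($n\in\mathbb{Z}$), $K$, and brackets $[e_n,e_m]=[f_n,f_m]=0$, $[e_n,f_m]=h_{n+m}+n\delta_{n,-m}K$, $[h_n,e_m]=2e_{n+m}$, $[h_n,f_m]=-2f_{n+m}$, $[h_n,h_m]=2n\delta_{n,-m}K$, $K$ central. Put $\hat{\mathfrak n}_+=\langle e_0\rangle+\sum_{k>0}t^k\mathfrak{sl}_2$. The module $L_{(0,1)}$ is the irreducible module with cyclic vector $v$ such that $\hat{\mathfrak n}_+v=0$, $h_0v=0$, $Kv=v$. Realization of $L_{(0,1)}$: let $a_n$ ($n\in\mathbb{Z}$) satisfy $[a_n,a_m]=n\delta_{n+m,0}$, and let $F_\lambda$ be the bosonic Fock module generated by $|\lambda\rangle$ with $a_n|\lambda\rangle=0$ for $n>0$ and $a_0|\lambda\rangle=\lambda|\lambda\rangle$. Then $L_{(0,1)}=\bigoplus_{m\in\mathbb{Z}}F_{m\sqrt2}$, with $K=1$ and with currents $x(z)=\sum_n x_nz^{-n-1}$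 ($x=e,f,h$) acting by $e(z)={:}\exp(\sqrt2\varphi(z)){:}$, $f(z)={:}\exp(-\sqrt2\varphi(z)){:}$, $h(z)=\sqrt2\,\partial\varphi(z)$, where $\varphi(z)=\mathbf{q}+a_0\log z+\sum_{n\ne0}\frac{a_n}{-n}z^{-n}$, $[a_0,\mathbf{q}]=1$, $\mathbf{q}$ commutes with $a_n$ for $n\neq 0$, and $\exp(\pm\sqrt2\,\mathbf{q})|\lambda\rangle=|\lambda\pm\sqrt2\rangle$. Normal ordering puts $\mathbf{q}$ and $a_n$, $n<0$, to the left of $a_n$, $n\ge0$. The highest weight vector is $|0\rangle$. $L_0$ is the zero mode of the stress-energy tensor $L(z)=\sum_nL_nz^{-n-2}=\frac12{:}a(z)^2{:}$ with $a(z)=\sum_n a_nz^{-n-1}$, i.e. $L_0=\frac12a_0^2+\sum_{n>0}a_{-n}a_n$. In the character $q$ and $z$ are formal variables, and $(q)_n=\prod_{i=1}^n(1-q^i)$, $(q)_0=1$. *)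

(* Defs.v *)
From HB Require Import structures.
From mathcomp Require Import all_boot all_order all_algebra.
From mathcomp Require Import finmap monalg complex.
From mathcomp Require Import classical_sets cardinality fsbigop reals.

Set Implicit Arguments.
Unset Strict Implicit.
Unset Printing Implicit Defensive.

Import Order.TTheory GRing.Theory Num.Theory.

Local Open Scope ring_scope.

(** * The realization of L_(0,1) as a direct sum of bosonic Fock modules *)

(** The basis vector [(m, mu)] is [(\prod_k a_(-(k+1)) ^ (mu k)) |m sqrt 2>]:
    the variable of index [k : nat] stands for the mode [a_(-(k+1))].          *)
Definition fock_basis : choiceType := (int * {cmonom nat})%type.

(** The free module on [fock_basis], that is [\bigoplus_(m : int) F_(m sqrt 2)]
    with [F_lambda] the space of polynomials in [a_(-1), a_(-2), ...].         *)
Notation fock C := {malg C[fock_basis]}.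

Section Fock.
Variable C : numClosedFieldType.
Implicit Types (v : fock C) (b : fock_basis) (m n : int).

Definition ket m : fock C := << ((m, mone) : fock_basis) >>.

Definition basis_lift (F : fock_basis -> fock C) v : fock C :=
  \sum_(b <- msupp v) v@_b *: F b.

(** [a_(-n)] multiplies by the corresponding variable, [a_n] is [n] times the
    partial derivative with respect to it ([n > 0]), and [a_0] is the scalar
    [m sqrt 2] on [F_(m sqrt 2)].                                              *)
Definition a_basis n b : fock C :=
  match n with
  | Posz 0 => (sqrtC 2 *~ b.1) *: << b >>
  | Posz k.+1 =>
      (k.+1 * b.2 k)%:R *: << ((b.1, divcm b.2 (ucm k)) : fock_basis) >>
  | Negz k => << ((b.1, mmul b.2 (ucm k)) : fock_basis) >>
  end.

Definition a n : fock C -> fock C := basis_lift (a_basis n).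

(** [exp (s sqrt 2 q)] maps [|m sqrt 2>] to [|(m + s) sqrt 2>] and commutes with
    [a_n] for [n <> 0].                                                        *)
Definition expq (s : int) : fock C -> fock C :=
  basis_lift (fun b => << ((b.1 + s, b.2) : fock_basis) >>).

(** The projection onto the summand [F_(m sqrt 2)]. *)
Definition sector m : fock C -> fock C :=
  basis_lift (fun b => if b.1 == m then << b >> else 0).

End Fock.

(** ** Exponentials of operator-valued formal power series *)

Section OperatorSeries.
Variables (C : fieldType) (V : lmodType C).

(** [A n] is the coefficient of [w ^ n]; products are Cauchy products. *)
Fixpoint opseries_pow (A : nat -> V -> V) (k : nat) : nat -> V -> V :=
  if k is k'.+1 then
    fun n v => \sum_(i < n.+1) A i (opseries_pow A k' (n - i)%N v)
  else fun n v => if n == 0%N then v else 0.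

(** The coefficient of [w ^ n] in [\sum_k A ^ k / k!] when [A 0 = 0], in which
    case [A ^ k] does not contribute for [k > n].                              *)
Definition opseries_exp (A : nat -> V -> V) (n : nat) (v : V) : V :=
  \sum_(k < n.+1) (k`!%:R)^-1 *: opseries_pow A k n v.

End OperatorSeries.

(** ** The currents and the stress-energy tensor *)

Section Currents.
Variable C : numClosedFieldType.
Implicit Types (v : fock C) (n : int) (s : int).

(** For [n <> 0], the coefficient [a_n / (- n)] of [z ^ (- n)] in [phi(z)]. It is
    [0] for [n = 0], as [0^-1 = 0]: the terms [q + a_0 log z] of [phi(z)] are
    exponentiated separately.                                                  *)
Definition phi_mode n v : fock C := (- n)%:~R^-1 *: a n v.

(** The coefficient of [z ^ j], resp. of [z ^ (- k)], in the exponential of the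
    part of [s sqrt 2 phi(z)] in the modes of negative, resp. positive, index. *)
Definition creation s (j : nat) : fock C -> fock C :=
  opseries_exp (fun i v => (sqrtC 2 *~ s) *: phi_mode (- i%:Z) v) j.
Definition annihilation s (k : nat) : fock C -> fock C :=
  opseries_exp (fun i v => (sqrtC 2 *~ s) *: phi_mode i%:Z v) k.

(** The coefficient of [z ^ N] in [: exp (s sqrt 2 phi(z)) :], which is
      [exp (\sum_(n>0) s sqrt 2 a_(-n) z^n / n) exp (s sqrt 2 q)
         z ^ (s sqrt 2 a_0) exp (- \sum_(n>0) s sqrt 2 a_n z^(-n) / n)].
    The factor [z ^ (s sqrt 2 a_0)] is [z ^ (2 s m)] on [F_(m sqrt 2)]. The sum
    ranges over all triples [(j, m, k)] of exponents giving the power [N]; it has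
    finite support on every vector.                                            *)
Definition vertex s (N : int) v : fock C :=
  \sum_(x \in [set x : nat * int * nat |
                x.1.1%:Z + 2 * s * x.1.2 - x.2%:Z = N]%classic)
     creation s x.1.1 (expq s (sector x.1.2 (annihilation s x.2 v))).

(** The modes of the currents [x(z) = \sum_n x_n z ^ (- n - 1)]; the central element
    [K] acts as the identity.                                                  *)
Definition e n : fock C -> fock C := vertex 1 (- n - 1).
Definition f n : fock C -> fock C := vertex (- 1) (- n - 1).
Definition h n v : fock C := sqrtC 2 *: a n v.

(** The sum has finite support on every vector. *)
Definition L0 v : fock C :=
  2^-1 *: a 0 (a 0 v)
  + \sum_(n \in [set n : nat | (0 < n)%N]%classic) a (- n%:Z) (a n%:Z v).

Definition half_h0 v : fock C := 2^-1 *: h 0 v.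

(** The basic subspace [C[e_(-1), e_(-2), ...] |0>]: linear combinations of
    products of the operators [e_(-(i+1))] applied to [|0>].                   *)
Definition W0 : set (fock C) := [set v |
  exists s : seq (C * seq nat),
    v = \sum_(x <- s) x.1 *: foldr (fun i w => e (- i.+1%:Z) w) (ket C 0) x.2
  ]%classic.

End Currents.

Arguments L0 : clear implicits.
Arguments half_h0 : clear implicits.
Arguments W0 : clear implicits.

(** * Characters *)

Section Characters.
Variables (C : numFieldType) (V : lmodType C).
Implicit Types (U W : set V) (X Y : V -> V).

Definition has_dim U (k : nat) : Prop :=
  exists b : 'I_k -> V,
    [/\ forall i, U (b i),
        forall c : 'I_k -> C, \sum_i c i *: b i = 0 -> forall i, c i = 0
      & forall v, U v -> exists c : 'I_k -> C, v = \sum_i c i *: b i].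

Definition weight_space W X Y (n d : nat) : set V :=
  [set v | [/\ W v, X v = n%:R *: v & Y v = d%:R *: v]]%classic.

(** [Tr_W (z ^ X q ^ Y) = \sum_(n, d) (c n d) z ^ n q ^ d] as formal series: [W]
    is the sum of its simultaneous eigenspaces for eigenvalues [(n, d)] in
    [nat * nat] (so that no other pair of eigenvalues occurs), and the one for
    [(n, d)] has finite dimension [c n d].                                     *)
Definition has_character W X Y (c : nat -> nat -> int) : Prop :=
  (forall v, W v -> exists2 s : seq (nat * nat * V),
     (forall x, x \in s -> weight_space W X Y x.1.1 x.1.2 x.2)
     & v = \sum_(x <- s) x.2)
  /\ (forall n d, exists2 k, has_dim (weight_space W X Y n d) k & c n d = k%:Z).

End Characters.

(** * Formal power series in q *)

Section FormalSeries.
Variable R : comUnitRingType.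
Implicit Types f g : nat -> R.

Definition fps_mul f g : nat -> R := fun d => \sum_(i < d.+1) f i * g (d - i)%N.

Definition fps_of_poly (p : {poly R}) : nat -> R := fun d => p`_d.

(** The inverse of [f], for [f 0] invertible, by the recursion
    [g d = - (f 0)^-1 * \sum_(1 <= i <= d) f i * g (d - i)]; [fuel] bounds the
    recursion depth.                                                           *)
Fixpoint fps_inv_rec f (fuel d : nat) : R :=
  if fuel is fuel'.+1 then
    if d == 0%N then (f 0%N)^-1
    else - (f 0%N)^-1 * \sum_(i < d) f i.+1 * fps_inv_rec f fuel' (d - i.+1)%N
  else 0.

Definition fps_inv f : nat -> R := fun d => fps_inv_rec f d.+1 d.

Lemma fps_inv_rec_fuel f k l d : (d < k)%N -> (d < l)%N ->
  fps_inv_rec f k d = fps_inv_rec f l d.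
Proof.
elim: k l d => [//|k IHk] [//|l] d ltdk ltdl /=; case: ifP => // _.
congr (_ * _); apply: eq_bigr => i _; congr (_ * _).
have lt_di : (d - i.+1 < d)%N by rewrite ltn_subrL (leq_ltn_trans _ (ltn_ord i)).
by apply: IHk; exact: leq_trans lt_di _.
Qed.

Lemma fps_invS f d : fps_inv f d.+1 =
  - (f 0%N)^-1 * \sum_(i < d.+1) f i.+1 * fps_inv f (d - i)%N.
Proof.
rewrite {1}/fps_inv; have -> k : fps_inv_rec f k.+1 d.+1 = - (f 0%N)^-1 *
    \sum_(i < d.+1) f i.+1 * fps_inv_rec f k (d - i)%N by [].
congr (_ * _); apply: eq_bigr => i _; congr (_ * _).
by apply: fps_inv_rec_fuel => //; rewrite ltnS leq_subr.
Qed.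

Lemma fps_mulV f : f 0%N \is a GRing.unit ->
  forall d, fps_mul f (fps_inv f) d = (d == 0%N)%:R.
Proof.
move=> f0U [|d]; rewrite /fps_mul big_ord_recl /=.
  by rewrite big_ord0 addr0 subn0 divrr.
by rewrite subn0 fps_invS mulrA mulrN divrr // mulN1r addNr.
Qed.

End FormalSeries.

(** [(q)_n] *)
Definition qpoch (n : nat) : {poly int} := \prod_(1 <= i < n.+1) (1 - 'X^i).

(* Main.v *)
Require Import Defs.
From HB Require Import structures.
From mathcomp Require Import all_boot all_order all_algebra.
From mathcomp Require Import finmap monalg complex reals.
From mathcomp Require Import classical_sets fsbigop zify ring.

(** Write [H_j] for the coefficient of [z ^ j] in the creation part
    [exp (\sum_(n>0) sqrt 2 a_(-n) z^n / n)] of [e(z)]. These operators commute,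
    and [H_0 = 1]. The whole proof rests on one description of [W0]: its part of
    charge [n] is spanned by all states [H_(j_1) ... H_(j_n) |n sqrt 2>] with
    [n] factors, and the only linear relations between these come from
    reordering the factors.

    - The exponential [A(w)] of the annihilation part, with coefficient [A_k] at
      [w ^ k], satisfies [A(w) H_j = (H_j - 2 w H_(j-1) + w^2 H_(j-2)) A(w)]
      ([annih_sqrt2_creat]) and fixes the vacuum. So [A_k] maps a state with [n]
      factors and total index [d] to a combination of states with [n] factors
      and total index [d - k], and [e_(-i-1)] prepends to each of these a factor
      [H_(i - 2n + k)]. Hence [W0] lies in the span ([e_charged]).
    - Conversely, on a state [X] with [n] factors, [e_(-(j + 2n)-1) X] is
      [H_j X] plus terms [H_(j+k) A_k X] with [k > 0], in which the tail has
      smaller total index. Induction on the total index of the tail puts all the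
      states into [W0] ([W0_hstate]).
    - Replacing [sqrt 2] by [1 / sqrt 2] in the annihilation part gives a series
      [B(w)] with [B(w) H_j = (H_j - w H_(j-1)) B(w)]. Its coefficient [B_n]
      kills the states with fewer than [n] factors of positive index and lowers
      by one every index of the states with [n] of them
      ([annih_invsqrt2_top]). This matches the recursion for partitions with at
      most [n] parts, either fewer than [n] parts or the parts lowered by one, and
      yields independence and the count [1 / (q)_n] together
      ([partition_basis]).

    Since [L0] is [n ^ 2] plus the total index on such a state, the part of
    charge [n] has character [q ^ (n ^ 2) / (q)_n]. *)

Set Implicit Arguments.
Unset Strict Implicit.
Unset Printing Implicit Defensive.

Import Order.TTheory GRing.Theory Num.Theory.
Local Open Scope ring_scope.

(** * Sums over triangles and exponentials of operator series *)

Section Triangle.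
Variable V : nmodType.

Lemma triangle_sum_exchange n (F : nat -> nat -> V) :
  \sum_(i < n.+1) \sum_(l < (n - i).+1) F i l
  = \sum_(l < n.+1) \sum_(i < (n - l).+1) F i l.
Proof.
have H (G : nat -> nat -> V) : \sum_(i < n.+1) \sum_(l < (n - i).+1) G i l
   = \sum_(i < n.+1) \sum_(l < n.+1 | (i + l <= n)%N) G i l.
  apply: eq_bigr => i _; have lti := ltn_ord i.
  rewrite (big_ord_widen_cond n.+1 xpredT (fun l => G i l)); last first.
    by rewrite ltnS leq_subr.
  apply: eq_bigl => l /=; rewrite ltnS leq_subRL //.
rewrite H (H (fun l i => F i l)) (exchange_big_dep xpredT) //=.
by apply: eq_bigr => l _; apply: eq_bigl => i; rewrite addnC.
Qed.

Lemma triangle_sum_diag n (F : nat -> nat -> V) :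
  \sum_(i < n.+1) \sum_(r < (n - i).+1) F i r
  = \sum_(s < n.+1) \sum_(r < s.+1) F (s - r)%N r.
Proof.
elim: n => [|n IHn]; first by rewrite !big_ord1.
under eq_bigr => i _ do rewrite big_ord_recr /=.
rewrite big_split /= [RHS]big_ord_recr /=; congr (_ + _).
  rewrite big_ord_recr /= subnn big_ord0 addr0 -IHn; apply: eq_bigr => i _.
  by rewrite subSn // -ltnS.
rewrite (reindex_inj rev_ord_inj) /=; apply: eq_bigr => i _.
by rewrite subSS subKn // -ltnS.
Qed.
End Triangle.

Section ExpSeries.
Variables (C : numFieldType) (V : lmodType C) (A : nat -> {linear V -> V}).

Lemma opseries_pow_linear k n : linear (opseries_pow A k n).
Proof.
elim: k n => [|k IHk] n c u v /=; first by case: eqP; rewrite ?scaler0 ?addr0.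
rewrite scaler_sumr -big_split /=; apply: eq_bigr => i _.
by rewrite IHk linearP.
Qed.
HB.instance Definition _ k n :=
  GRing.isLinear.Build C V V *:%R (opseries_pow A k n) (opseries_pow_linear k n).

Lemma opseries_exp_linear n : linear (opseries_exp A n).
Proof.
move=> c u v; rewrite /opseries_exp scaler_sumr -big_split /=.
by apply: eq_bigr => i _; rewrite linearP scalerDr !scalerA mulrC.
Qed.
HB.instance Definition _ n :=
  GRing.isLinear.Build C V V *:%R (opseries_exp A n) (opseries_exp_linear n).

Lemma opseries_exp_commute (T : {linear V -> V}) :
  (forall i v, T (A i v) = A i (T v)) ->
  forall n v, T (opseries_exp A n v) = opseries_exp A n (T v).
Proof.
move=> TA n v; rewrite /opseries_exp linear_sum; apply: eq_bigr => k _.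
rewrite linearZ /=; congr (_ *: _).
move: (k : nat) => {}k; elim: k n v => [|l IHl] n v /=; first by case: eqP; rewrite ?linear0.
by rewrite linear_sum; apply: eq_bigr => i _; rewrite TA IHl.
Qed.

Lemma opseries_exp0 v : opseries_exp A 0 v = v.
Proof. by rewrite /opseries_exp big_ord1 fact0 invr1 scale1r. Qed.

Hypothesis A0 : forall v, A 0 v = 0.
Hypothesis AC : forall i j v, A i (A j v) = A j (A i v).

(** As the constant term vanishes, every factor raises the order by one. *)
Lemma opseries_pow_small k n v : (n < k)%N -> opseries_pow A k n v = 0.
Proof.
elim: k n => [//|k IHk] n ltnk /=; rewrite big1 // => -[[|i] lti] _ /=.
  by rewrite A0.
rewrite IHk ?linear0 //.
apply: (@leq_trans n) => //; rewrite ltn_subrL /=.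
exact: leq_ltn_trans (leq0n i) lti.
Qed.

(** The Euler operator [w d/dw] is a derivation, and the coefficients commute:
    [w d/dw A^(k+1) = (k + 1) (w d/dw A) A^k]. *)
Lemma opseries_pow_euler k n v : n%:R *: opseries_pow A k.+1 n v =
  k.+1%:R *: \sum_(i < n.+1) i%:R *: A i (opseries_pow A k (n - i) v).
Proof.
elim: k n v => [|k IHk] n v.
  rewrite mulr1n scale1r /= scaler_sumr; apply: eq_bigr => i _.
  case: (eqVneq (n - i)%N 0%N) => [/eqP|_]; last by rewrite !linear0.
  rewrite subn_eq0 => le_ni; suff -> : i = n :> nat by [].
  by apply/anti_leq; rewrite le_ni -ltnS ltn_ord.
have -> : n%:R *: opseries_pow A k.+2 n v =
    \sum_(i < n.+1) i%:R *: A i (opseries_pow A k.+1 (n - i) v)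
    + \sum_(i < n.+1) A i ((n - i)%N%:R *: opseries_pow A k.+1 (n - i) v).
  rewrite -big_split /= scaler_sumr; apply: eq_bigr => i _.
  by rewrite linearZ /= -scalerDl -natrD subnKC // -ltnS.
rewrite [k.+2%:R]mulrS scalerDl scale1r; congr (_ + _).
under eq_bigr => i _ do rewrite IHk linearZ /= linear_sum /=.
rewrite -scaler_sumr; congr (_ *: _).
under eq_bigr => i _.
  under eq_bigr => l _ do rewrite linearZ /= AC -subnDA.
  over.
rewrite (triangle_sum_exchange n
  (fun i l => l%:R *: A l (A i (opseries_pow A k (n - (i + l)) v)))).
apply: eq_bigr => l _; rewrite -scaler_sumr; congr (_ *: _); rewrite linear_sum.
by apply: eq_bigr => i _; rewrite addnC subnDA.
Qed.

(** The differential equation [w d/dw exp A = (w d/dw A) exp A], read off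
    coefficientwise. It turns statements about the exponential into inductions on
    the order. *)
Lemma opseries_exp_euler n v : n.+1%:R *: opseries_exp A n.+1 v =
  \sum_(i < n.+1) i.+1%:R *: A i.+1 (opseries_exp A (n - i) v).
Proof.
have step k : n.+1%:R *: ((k.+1`!%:R)^-1 *: opseries_pow A k.+1 n.+1 v) =
    \sum_(i < n.+1) i.+1%:R *:
      A i.+1 ((k`!%:R)^-1 *: opseries_pow A k (n - i) v).
  rewrite scalerA mulrC -scalerA (opseries_pow_euler k n.+1) scalerA.
  rewrite factS natrM invfM mulrAC mulVf ?pnatr_eq0 // mul1r.
  rewrite big_ord_recl scale0r add0r scaler_sumr; apply: eq_bigr => i _.
  by rewrite /= /bump add1n subSS [A _ (_ *: _)]linearZ /= !scalerA mulrC.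
rewrite {1}/opseries_exp big_ord_recl scaler0 add0r scaler_sumr.
rewrite (eq_bigr _ (fun (k : 'I_n.+1) _ => step k)) exchange_big /=.
apply: eq_bigr => i _; rewrite -scaler_sumr -linear_sum /opseries_exp.
have le_i : ((n - i).+1 <= n.+1)%N by rewrite ltnS leq_subr.
rewrite [in RHS](big_ord_widen n.+1 (fun k => (k`!%:R)^-1 *:
  opseries_pow A k (n - i) v) le_i) [in RHS]big_mkcond /=.
congr (_ *: A _ _); apply: eq_bigr => k _; case: ltnP => // lt_k.
by rewrite opseries_pow_small ?scaler0.
Qed.

End ExpSeries.

(** * Mode operators on the Fock space *)

Section FockOperators.
Variable C : numClosedFieldType.
Implicit Types (v w : fock C) (b : fock_basis) (F : fock_basis -> fock C).

Lemma basis_lift_wide F v (D : {fset fock_basis}) : (msupp v `<=` D)%fset ->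
  basis_lift F v = \sum_(b <- D) v@_b *: F b.
Proof.
move=> leD; rewrite /basis_lift (big_fset_incl _ leD) // => b _.
by rewrite -mcoeff_neq0 negbK => /eqP ->; rewrite scale0r.
Qed.

Lemma basis_lift_linear F : linear (basis_lift F).
Proof.
move=> c u v; pose D := (msupp u `|` msupp v `|` msupp (c *: u + v))%fset.
have [hu hv huv] : [/\ msupp u `<=` D, msupp v `<=` D
    & msupp (c *: u + v) `<=` D]%fset.
  by split; apply/fsubsetP => b; rewrite !inE => ->; rewrite ?orbT.
rewrite (basis_lift_wide F hu) (basis_lift_wide F hv) (basis_lift_wide F huv).
rewrite scaler_sumr -big_split /=; apply: eq_bigr => b _.
by rewrite mcoeffD mcoeffZ scalerDl scalerA.
Qed.
HB.instance Definition _ F := GRing.isLinear.Build C (fock C) (fock C) *:%R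
  (basis_lift F) (basis_lift_linear F).
HB.instance Definition _ n := GRing.Linear.copy (@a C n) (basis_lift (a_basis C n)).
HB.instance Definition _ s := GRing.Linear.copy (@expq C s)
  (basis_lift (fun b => << ((b.1 + s, b.2) : fock_basis) >>)).
HB.instance Definition _ m := GRing.Linear.copy (@sector C m)
  (basis_lift (fun b => if b.1 == m then << b >> else 0)).

Lemma basis_liftU F b : basis_lift F << b >> = F b.
Proof. by rewrite /basis_lift msuppU oner_eq0 big_seq_fset1 mcoeffUU scale1r. Qed.

Lemma fock_basisE v : v = \sum_(b <- msupp v) v@_b *: << b >>.
Proof.
rewrite {1}[v]monalgE; apply: eq_bigr => b _; apply/malgP => b'.
by rewrite mcoeffZ !mcoeffU mulr_natr.
Qed.

Lemma fock_linear_ext (S T : {linear fock C -> fock C}) :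
  (forall b, S << b >> = T << b >>) -> forall v, S v = T v.
Proof.
move=> ST v; rewrite [v]fock_basisE !linear_sum; apply: eq_bigr => b _.
by rewrite !linearZ ST.
Qed.

Lemma basis_lift_neq0 F v b : (basis_lift F v)@_b != 0 ->
  exists2 b', v@_b' != 0 & (F b')@_b != 0.
Proof.
rewrite /basis_lift raddf_sum /= => nz.
have /hasP[b' b'v /=] : has (fun b' => (v@_b' *: F b')@_b != 0) (msupp v).
  apply: contraNT nz => /hasPn h; rewrite big_seq big1 // => b' /h.
  by rewrite negbK => /eqP.
rewrite mcoeffZ mulf_eq0 negb_or => /andP[h1 h2]; by exists b'.
Qed.

Lemma a_raiseU k b : a (- k.+1%:Z) << b >> =
  << ((b.1, mmul b.2 (ucm k)) : fock_basis) >> :> fock C.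
Proof. exact: basis_liftU. Qed.

Lemma a_lowerU k b : a k.+1%:Z << b >> =
  (k.+1 * b.2 k)%:R *: << ((b.1, divcm b.2 (ucm k)) : fock_basis) >> :> fock C.
Proof. exact: basis_liftU. Qed.

Lemma a_zeroU b : a 0 << b >> = (sqrtC 2 *~ b.1) *: << b >> :> fock C.
Proof. exact: basis_liftU. Qed.

Lemma expqU s b : expq s << b >> = << ((b.1 + s, b.2) : fock_basis) >> :> fock C.
Proof. exact: basis_liftU. Qed.

Lemma sectorU m b : sector m << b >> = (if b.1 == m then << b >> else 0) :> fock C.
Proof. exact: basis_liftU. Qed.

Lemma a_raiseC k l v : a (- k.+1%:Z) (a (- l.+1%:Z) v) = a (- l.+1%:Z) (a (- k.+1%:Z) v).
Proof.
apply: (@fock_linear_ext (@a C (- k.+1%:Z) \o @a C (- l.+1%:Z))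
  (@a C (- l.+1%:Z) \o @a C (- k.+1%:Z))) => b /=.
by rewrite !a_raiseU /= -!mulmA [mmul (ucm k) _]mulmC.
Qed.

Lemma a_lowerC k l v : a k.+1%:Z (a l.+1%:Z v) = a l.+1%:Z (a k.+1%:Z v).
Proof.
apply: (@fock_linear_ext (@a C k.+1%:Z \o @a C l.+1%:Z)
  (@a C l.+1%:Z \o @a C k.+1%:Z)) => b /=.
rewrite !a_lowerU !linearZ /= !a_lowerU !scalerA -!natrM /= !divcmE !cmU.
have -> : divcm (divcm b.2 (ucm l)) (ucm k) = divcm (divcm b.2 (ucm k)) (ucm l).
  by apply/eqP/cmP => i; rewrite !divcmE -!subnDA addnC.
congr (_%:R *: _); rewrite [l == k]eq_sym.
by case: (eqVneq k l) => [-> //|_]; rewrite !subn0 mulnC.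
Qed.

(** The Heisenberg relation. Where the exponent of the variable is [0], truncated
    subtraction gives a wrong monomial, but then its coefficient is [0]. *)
Lemma a_lower_raise k l v : a k.+1%:Z (a (- l.+1%:Z) v) =
  a (- l.+1%:Z) (a k.+1%:Z v) + (k.+1 * (k == l))%:R *: v.
Proof.
have zz (x y : fock C) : 0%:R *: x = 0%:R *: y by rewrite !scale0r.
pose S := @a C k.+1%:Z \o @a C (- l.+1%:Z).
pose T1 : {linear fock C -> fock C} := @a C (- l.+1%:Z) \o @a C k.+1%:Z.
apply: (@fock_linear_ext S (GRing.add_fun T1 ( *:%R (k.+1 * (k == l))%:R))) => b.
rewrite /S /T1 /= !(a_raiseU, a_lowerU) linearZ /= a_raiseU cmM cmU eq_sym.
case: (eqVneq k l) => [<-|ne_kl] /=; last first.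
  rewrite muln0 mulr0n scale0r !addn0; case: (posnP (b.2 k)) => [->|mu_gt0].
    by rewrite muln0 addr0; exact: zz.
  rewrite addr0; congr (_ *: << (_, _) >>); apply/eqP/cmP => i.
  rewrite !(divcmE, cmM, cmU); case: (eqVneq k i) => [<-|_]; last by rewrite !subn0.
  by rewrite eq_sym (negPf ne_kl) !addn0.
have -> : divcm (mmul b.2 (ucm k)) (ucm k) = b.2.
  by apply/eqP/cmP => i; rewrite !(divcmE, cmM, cmU) addnK.
rewrite -surjective_pairing mulnDr natrD scalerDl; congr (_ + _).
case: (posnP (b.2 k)) => [->|mu_gt0]; first by rewrite muln0; exact: zz.
rewrite [b in LHS]surjective_pairing.
congr (_ *: << (_, _) >>); apply/eqP/cmP => i.
rewrite !(divcmE, cmM, cmU); case: (eqVneq k i) => [<-|_]; last by rewrite subn0 addn0.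
by rewrite subnK.
Qed.

Lemma expq_a n s v : n != 0 -> expq s (a n v) = a n (expq s v).
Proof.
move=> nz; apply: (@fock_linear_ext (@expq C s \o @a C n)
  (@a C n \o @expq C s)) => b /=.
case: n nz => [[//|k]|k] _.
  by rewrite expqU !a_lowerU linearZ /= expqU.
by rewrite NegzE expqU !a_raiseU expqU.
Qed.

Lemma sector_a n m v : sector m (a n v) = a n (sector m v).
Proof.
apply: (@fock_linear_ext (@sector C m \o @a C n)
  (@a C n \o @sector C m)) => b /=.
rewrite sectorU; case: n => [[|k]|k]; last rewrite NegzE.
- rewrite a_zeroU linearZ /= sectorU.
  by case: ifP => _; rewrite ?linear0 ?a_zeroU // scaler0.
- rewrite a_lowerU linearZ /= sectorU /=.
  by case: ifP => _; rewrite ?linear0 ?a_lowerU // scaler0.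
- by rewrite a_raiseU sectorU /=; case: ifP => _; rewrite ?linear0 ?a_raiseU.
Qed.

Lemma sector_ket m n : sector m (ket C n) = if n == m then ket C n else 0.
Proof. exact: sectorU. Qed.

Lemma expq_ket s m : expq s (ket C m) = ket C (m + s).
Proof. exact: expqU. Qed.

Lemma a_lower_ket k m : a k.+1%:Z (ket C m) = 0.
Proof. by rewrite a_lowerU cm1 muln0 mulr0n scale0r. Qed.

End FockOperators.

(** * Grading, and the diagonal action of the zero modes *)

(** The eigenvalue of [\sum_(n>0) a_(-n) a_n] on a monomial: the variable of index
    [k] stands for [a_(-(k+1))]. *)
Definition level (mu : {cmonom nat}) : nat :=
  (\sum_(k <- finsupp mu) k.+1 * mu k)%N.

Lemma level_wide (mu : {cmonom nat}) (D : {fset nat}) :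
  (finsupp mu `<=` D)%fset -> level mu = (\sum_(k <- D) k.+1 * mu k)%N.
Proof.
move=> leD; rewrite /level (big_fset_incl _ leD) // => k _.
by rewrite -cmE_neq0 negbK => /eqP ->; rewrite muln0.
Qed.

Lemma levelM (mu nu : {cmonom nat}) : level (mmul mu nu) = (level mu + level nu)%N.
Proof.
rewrite {1}/level mdomD (level_wide (fsubsetUl _ (finsupp nu))).
rewrite (level_wide (fsubsetUr (finsupp mu) _)) -big_split /=.
by apply: eq_bigr => k _; rewrite cmM mulnDr.
Qed.

Lemma levelU k : level (ucm k) = k.+1.
Proof. by rewrite /level mdomU big_seq_fset1 cmUU muln1. Qed.

Lemma level1 : level mone = 0%N.
Proof. by rewrite /level mdom1 big_seq_fset0. Qed.

Lemma level_gt (mu : {cmonom nat}) k : mu k != 0%N -> (k < level mu)%N.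
Proof.
rewrite cmE_neq0 => k_mu; rewrite /level (big_fsetD1 k) //=.
apply: leq_trans (leq_addr _ _); rewrite leq_pmulr // lt0n.
by rewrite cmE_neq0.
Qed.

Lemma level_ord (mu : {cmonom nat}) K : (level mu <= K)%N ->
  level mu = (\sum_(k < K) k.+1 * mu k)%N.
Proof.
move=> leK; rewrite -(big_mkord xpredT (fun k => (k.+1 * mu k)%N)).
rewrite (@level_wide mu [fset k in iota 0 K]%fset); last first.
  apply/fsubsetP => k; rewrite -cmE_neq0 => /level_gt lt_k.
  by rewrite !inE mem_iota /= add0n (leq_trans lt_k).
rewrite /index_iota subn0; apply: perm_big; apply: uniq_perm => [||k].
- exact: fset_uniq.
- exact: iota_uniq.
by rewrite !inE.
Qed.

Section Weights.
Variable C : numClosedFieldType.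
Implicit Types (v w : fock C) (b : fock_basis) (m : int) (d : nat).

Definition graded m d v := forall b, v@_b != 0 -> b.1 = m /\ level b.2 = d.

Lemma graded0 m d : graded m d 0.
Proof. by move=> b; rewrite mcoeff0 eqxx. Qed.

Lemma gradedD m d v w : graded m d v -> graded m d w -> graded m d (v + w).
Proof.
move=> gv gw b; rewrite mcoeffD; case: (eqVneq v@_b 0) => [->|/gv //].
by rewrite add0r => /gw.
Qed.

Lemma gradedZ m d c v : graded m d v -> graded m d (c *: v).
Proof. by move=> gv b; rewrite mcoeffZ mulf_eq0 negb_or => /andP[_ /gv]. Qed.

Lemma graded_sum m d (I : Type) (r : seq I) (P : pred I) (F : I -> fock C) :
  (forall i, P i -> graded m d (F i)) -> graded m d (\sum_(i <- r | P i) F i).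
Proof. by apply: big_ind; [exact: graded0 | exact: gradedD]. Qed.

Lemma graded_ket m : graded m 0 (ket C m).
Proof.
move=> b; rewrite mcoeffU; case: (eqVneq _ b) => [<- _|_]; last by rewrite mulr0n eqxx.
by rewrite level1.
Qed.

Lemma graded_raise m d k v : graded m d v ->
  graded m (d + k.+1) (a (- k.+1%:Z) v).
Proof.
move=> gv b /basis_lift_neq0[b' /gv[<- <-]].
rewrite mcoeffU; case: (eqVneq _ b) => [<- _|_]; last by rewrite mulr0n eqxx.
by rewrite levelM levelU.
Qed.

(** Each of the operators [h_0 / 2], [a_(-n) a_n] and [L0] is diagonal in the
    monomial basis; this reads off its eigenvalues. *)
Lemma diagonal_mcoeff (c : fock_basis -> C) v b :
  (basis_lift (fun b => c b *: << b >>) v)@_b = c b * v@_b.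
Proof.
rewrite [v in RHS]fock_basisE /basis_lift !raddf_sum /= mulr_sumr.
apply: eq_bigr => b' _; rewrite !mcoeffZ mcoeffU.
by case: (eqVneq b' b) => [->|_]; rewrite ?mulr1n ?mulr0n ?mulr0 // mulrCA.
Qed.

Lemma a_zero_mcoeff v b : (a 0 v)@_b = (sqrtC 2 *~ b.1) * v@_b.
Proof. exact: (diagonal_mcoeff (fun b => sqrtC 2 *~ b.1)). Qed.

Lemma half_h0_mcoeff v b : (half_h0 C v)@_b = b.1%:~R * v@_b.
Proof.
rewrite /half_h0 /h !mcoeffZ a_zero_mcoeff -mulrzr !mulrA -[2^-1 * _ * _]mulrA.
by rewrite -expr2 sqrtCK mulVf ?mul1r // pnatr_eq0.
Qed.

Lemma number_mcoeff k v b :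
  (a (- k.+1%:Z) (a k.+1%:Z v))@_b = (k.+1 * b.2 k)%:R * v@_b.
Proof.
rewrite -(diagonal_mcoeff (fun b => (k.+1 * b.2 k)%:R)); congr (_ @_ b).
pose N : {linear fock C -> fock C} :=
  basis_lift (fun b => (k.+1 * b.2 k)%:R *: << b >> : fock C).
suff NE b' : (@a C (- k.+1%:Z) \o @a C k.+1%:Z) << b' >> = N << b' >>.
  exact: (fock_linear_ext NE v).
rewrite /= {b}; move: b' => b.
rewrite a_lowerU basis_liftU linearZ /= a_raiseU.
have zz (x y : fock C) : 0%:R *: x = 0%:R *: y by rewrite !scale0r.
case: (posnP (b.2 k)) => [->|b_gt0]; first by rewrite muln0; exact: zz.
rewrite [b in RHS]surjective_pairing.
congr (_ *: << (_, _) >>); apply/eqP/cmP => i.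
rewrite !(divcmE, cmM, cmU); case: (eqVneq k i) => [<-|_].
  by rewrite subnK.
by rewrite subn0 addn0.
Qed.

(** A mode whose index exceeds the level of every monomial of [v] kills [v], which
    makes the sum in [L0] finite. *)
Lemma a_lower_large v k : (\max_(b <- msupp v) level b.2 <= k)%N ->
  a k.+1%:Z v = 0.
Proof.
move=> lek; apply/eqP; rewrite /a /basis_lift big_seq big1 // => b bv /=.
suff -> : b.2 k = 0%N by rewrite muln0 scale0r scaler0.
apply/eqP; apply: contraTT lek => /level_gt lt_k; rewrite -ltnNge.
by apply: leq_trans lt_k _; apply: (leq_bigmax_seq (F := fun b : fock_basis => level b.2)).
Qed.

Lemma L0_mcoeff v b :
  (L0 C v)@_b = (b.1%:~R ^+ 2 + (level b.2)%:R) * v@_b.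
Proof.
pose K := (\max_(b <- msupp v) level b.2)%N.
rewrite /L0 mcoeffD mcoeffZ !a_zero_mcoeff mulrDl; congr (_ + _).
  rewrite -mulrzr !mulrA; congr (_ * _).
  rewrite -[2^-1 * _ * _ * _]mulrA [b.1%:~R * _]mulrC !mulrA.
  rewrite -[2^-1 * _ * _]mulrA -[sqrtC 2 * _]expr2 sqrtCK mulVf ?pnatr_eq0 //.
  by rewrite mul1r expr2.
rewrite (fsbigE (iota 1 K)) ?iota_uniq //; first last.
- move=> [//|k] _; rewrite mem_iota add1n ltnS /= -ltnNge ltnS => le_k.
  by rewrite a_lower_large // linear0.
- by move=> k /=; rewrite mem_iota => /andP[].
have -> : \sum_(i <- iota 1 K | i \in [set n : nat | (0 < n)%N]%classic)
    a (- i%:Z) (a i%:Z v) = \sum_(k < K) a (- k.+1%:Z) (a k.+1%:Z v).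
  rewrite (iotaDl 1 0) big_map -(big_mkord xpredT (fun k => a (- k.+1%:Z) (a k.+1%:Z v))).
  rewrite /index_iota subn0; apply: eq_bigl => k.
  by rewrite mem_setE.
rewrite raddf_sum /=.
under eq_bigr => k _ do rewrite number_mcoeff.
rewrite -mulr_suml -natr_sum; case: (eqVneq v@_b 0) => [->|nz].
  by rewrite !mulr0.
congr (_%:R * _); rewrite -level_ord //.
apply: (leq_bigmax_seq (F := fun b : fock_basis => level b.2)) => //.
by rewrite -mcoeff_neq0.
Qed.

End Weights.

(** * The two exponential factors of the vertex operator *)

Section Exponentials.
Variable C : numClosedFieldType.
Implicit Types (v w : fock C) (c : C).

Definition raising c (i : nat) v : fock C := c *: phi_mode (- i%:Z) v.
Definition lowering c (i : nat) v : fock C := c *: phi_mode i%:Z v.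

Lemma raising_linear c i : linear (raising c i).
Proof.
move=> x u v; rewrite /raising /phi_mode linearP !scalerDr !scalerA.
by rewrite mulrAC [x * c]mulrC mulrAC.
Qed.
HB.instance Definition _ c i :=
  GRing.isLinear.Build C (fock C) (fock C) *:%R (raising c i) (raising_linear c i).

Lemma lowering_linear c i : linear (lowering c i).
Proof.
move=> x u v; rewrite /lowering /phi_mode linearP !scalerDr !scalerA.
by rewrite mulrAC [x * c]mulrC mulrAC.
Qed.
HB.instance Definition _ c i :=
  GRing.isLinear.Build C (fock C) (fock C) *:%R (lowering c i) (lowering_linear c i).

(** The coefficients of [exp (c \sum_(n>0) a_(-n) z^n / n)] and of
    [exp (- c \sum_(n>0) a_n z^(-n) / n)]. The charge [s] vertex operator has
    [c = s sqrt 2]; the value [c = 1 / sqrt 2] is needed for independence. *)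
Definition creat c := opseries_exp (raising c).
Definition annih c := opseries_exp (lowering c).

HB.instance Definition _ c j := GRing.isLinear.Build C (fock C) (fock C) *:%R
  (creat c j) (opseries_exp_linear (raising c) j).
HB.instance Definition _ c j := GRing.isLinear.Build C (fock C) (fock C) *:%R
  (annih c j) (opseries_exp_linear (lowering c) j).

Lemma raising0 c v : raising c 0 v = 0.
Proof. by rewrite /raising /phi_mode oppr0 mulr0z invr0 scale0r scaler0. Qed.

Lemma lowering0 c v : lowering c 0 v = 0.
Proof. by rewrite /lowering /phi_mode oppr0 mulr0z invr0 scale0r scaler0. Qed.

Lemma raisingS c k v : raising c k.+1 v = (c / k.+1%:R) *: a (- k.+1%:Z) v.
Proof. by rewrite /raising /phi_mode opprK scalerA. Qed.

Lemma loweringS c k v : lowering c k.+1 v = (- c / k.+1%:R) *: a k.+1%:Z v.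
Proof.
by rewrite /lowering /phi_mode scalerA mulrNz invrN mulrN -mulNr.
Qed.

Lemma raisingC c d i j v :
  raising c i (raising d j v) = raising d j (raising c i v).
Proof.
case: i => [|i]; first by rewrite [raising c 0 v]raising0 linear0; exact: raising0.
case: j => [|j]; first by rewrite [raising d 0 v]raising0 linear0; apply/esym/raising0.
rewrite [raising c _ v]raisingS [raising d _ v]raisingS !linearZ /=.
by rewrite raisingS raisingS a_raiseC !scalerA mulrC.
Qed.

Lemma loweringC c d i j v :
  lowering c i (lowering d j v) = lowering d j (lowering c i v).
Proof.
case: i => [|i]; first by rewrite [lowering c 0 v]lowering0 linear0; exact: lowering0.
case: j => [|j]; first by rewrite [lowering d 0 v]lowering0 linear0; apply/esym/lowering0.
rewrite [lowering c _ v]loweringS [lowering d _ v]loweringS !linearZ /=.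
by rewrite loweringS loweringS a_lowerC !scalerA mulrC.
Qed.

Lemma creat0 c v : creat c 0 v = v.
Proof. exact: (opseries_exp0 (raising c)). Qed.

Lemma annih0 c v : annih c 0 v = v.
Proof. exact: (opseries_exp0 (lowering c)). Qed.

Lemma creat_rec c k v : k.+1%:R *: creat c k.+1 v =
  c *: \sum_(i < k.+1) a (- i.+1%:Z) (creat c (k - i) v).
Proof.
rewrite (opseries_exp_euler (raising0 c) (raisingC c c)) scaler_sumr.
apply: eq_bigr => i _; rewrite /= raisingS scalerA mulrCA mulfV ?mulr1 //.
by rewrite pnatr_eq0.
Qed.

Lemma annih_rec c k v : k.+1%:R *: annih c k.+1 v =
  - c *: \sum_(i < k.+1) a i.+1%:Z (annih c (k - i) v).
Proof.
rewrite (opseries_exp_euler (lowering0 c) (loweringC c c)) scaler_sumr.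
apply: eq_bigr => i _; rewrite /= loweringS scalerA mulrCA mulfV ?mulr1 //.
by rewrite pnatr_eq0.
Qed.

Lemma creat_commute (T : {linear fock C -> fock C}) :
  (forall k v, T (a (- k.+1%:Z) v) = a (- k.+1%:Z) (T v)) ->
  forall c j v, T (creat c j v) = creat c j (T v).
Proof.
move=> TC c j v; apply: (opseries_exp_commute (A := raising c)) => -[|i] w.
  by rewrite /= raising0 [RHS]raising0 linear0.
by rewrite /= raisingS [RHS]raisingS linearZ /= TC.
Qed.

Lemma creatC c d i j v : creat c i (creat d j v) = creat d j (creat c i v).
Proof.
apply: creat_commute => k w; apply/esym.
by apply: creat_commute => l u; exact: a_raiseC.
Qed.

Lemma expq_creat s c j v : expq s (creat c j v) = creat c j (expq s v).
Proof. by apply: creat_commute => k w; apply: expq_a. Qed.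

Lemma sector_creat m c j v : sector m (creat c j v) = creat c j (sector m v).
Proof. by apply: creat_commute => k w; apply: sector_a. Qed.

Lemma graded_creat m d c j v : graded m d v -> graded m (d + j) (creat c j v).
Proof.
move=> gv; elim/ltn_ind: j => -[|j] IHj; first by rewrite creat0 addn0.
have nz : j.+1%:R != 0 :> C by rewrite pnatr_eq0.
rewrite -[creat _ _ _]scale1r -(mulVf nz) -scalerA creat_rec.
apply/gradedZ/gradedZ/graded_sum => i _.
have le_ij : (i <= j)%N by rewrite -ltnS.
suff -> : (d + j.+1 = (d + (j - i)) + i.+1)%N.
  by apply/graded_raise/IHj; rewrite ltnS leq_subr.
by rewrite -addnA [(j - i + i.+1)%N]addnS subnK.
Qed.

(** The operator [creat c (j - r)] for an integer difference of indices, which is [0]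
    when the difference is negative. *)
Definition creat_at c (j r : nat) v := if (r <= j)%N then creat c (j - r) v else 0.

Lemma creat_at_linear c j r : linear (creat_at c j r).
Proof.
by move=> x u v; rewrite /creat_at; case: ifP; rewrite ?linearP ?scaler0 ?addr0.
Qed.
HB.instance Definition _ c j r := GRing.isLinear.Build C (fock C) (fock C) *:%R
  (creat_at c j r) (creat_at_linear c j r).

Lemma creat_at0 c j v : creat_at c j 0 v = creat c j v.
Proof. by rewrite /creat_at subn0. Qed.

(** Truncating at [r] amounts to multiplying the series by [w ^ r], which commutes
    with the recursion of [creat]. *)
Lemma creat_at_rec c j r v : (j.+1 - r)%:R *: creat_at c j.+1 r v =
  c *: \sum_(i < j.+1) a (- i.+1%:Z) (creat_at c (j - i) r v).
Proof.
rewrite /creat_at; case: (leqP r j) => [le_rj|lt_jr]; last first.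
  rewrite (eqP (_ : j.+1 - r == 0)%N) ?subn_eq0 // scale0r.
  rewrite big1 ?scaler0 // => i _; rewrite ifN ?linear0 //.
  by rewrite -ltnNge (leq_ltn_trans (leq_subr i j)).
rewrite leqW // subSn // creat_rec; congr (_ *: _).
have le' : ((j - r).+1 <= j.+1)%N by rewrite ltnS leq_subr.
rewrite (big_ord_widen j.+1 (fun i => a (- i.+1%:Z) (creat c (j - r - i) v)) le').
rewrite big_mkcond /=; apply: eq_bigr => i _.
have le_ij : (i <= j)%N by rewrite -ltnS.
rewrite ltnS !leq_subRL // addnC; case: ifP => _; last by rewrite linear0.
by rewrite -!subnDA addnC.
Qed.

(** For [n > 0] the commutators [[a_n, a_(-i)]] are scalars, so commuting with [a_n]
    differentiates the exponential: [[a_n, creat c (z)] = c z^n creat c (z)]. *)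
Lemma a_lower_creat k c j v : a k.+1%:Z (creat c j v) =
  creat c j (a k.+1%:Z v) + c *: creat_at c j k.+1 v.
Proof.
elim/ltn_ind: j => -[|j] IHj; first by rewrite !creat0 scaler0 addr0.
have nz : j.+1%:R != 0 :> C by rewrite pnatr_eq0.
apply: (scalerI nz); rewrite scalerDr -linearZ creat_rec /=.
rewrite linearZ linear_sum /=.
under eq_bigr => i _.
  rewrite a_lower_raise IHj ?ltnS ?leq_subr // linearD linearZ /= -addrA; over.
rewrite big_split scalerDr -creat_rec /=; congr (_ + _).
rewrite big_split -scaler_sumr -creat_at_rec /= subSS scalerDr.
have -> : \sum_(i < j.+1) (k.+1 * (k == i))%:R *: creat c (j - i) v
     = k.+1%:R *: creat_at c j.+1 k.+1 v.
  rewrite /creat_at subSS ltnS; case: leqP => [le_kj|lt_jk].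
    rewrite (bigD1 (Ordinal (le_kj : k < j.+1)%N)) //= eqxx muln1 big1 ?addr0 //.
    move=> i ne_ik; rewrite eq_sym [_ == _](_ : _ = false) ?muln0 ?scale0r //.
    exact: negPf ne_ik.
  rewrite scaler0 big1 // => i _; rewrite gtn_eqF ?muln0 ?scale0r //.
  exact: leq_trans (ltn_ord i) _.
rewrite -scalerDr -scalerDl [RHS]scalerA [j.+1%:R * c]mulrC -scalerA.
rewrite /creat_at subSS ltnS; case: leqP => [le_kj|_]; last by rewrite !scaler0.
by rewrite -natrD addnS subnK.
Qed.

Lemma a_lower_creat_at k c j r v : a k.+1%:Z (creat_at c j r v) =
  creat_at c j r (a k.+1%:Z v) + c *: creat_at c j (r + k.+1) v.
Proof.
rewrite /creat_at; case: leqP => [le_rj|lt_jr].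
  by rewrite a_lower_creat /creat_at -subnDA leq_subRL.
by rewrite linear0 ifN ?scaler0 ?addr0 // -ltnNge ltn_addr.
Qed.

End Exponentials.

(** * Exchange of the two exponential factors *)

Section Exchange.
Variable C : numClosedFieldType.
Implicit Types (v w : fock C).

(** Generating function form:
    [annih c (w) creat d j = \sum_r b_r w^r creat d (j - r) annih c (w)], where
    [\sum_r b_r x^r = (1 - x)^(c d)]; the hypotheses on [b] are the differential
    equation of this binomial series. Both sides obey the recursion of [annih c],
    the extra terms from [a_lower_creat] being those of the recursion for [b]. *)
Lemma annih_creat (c d : C) (b : nat -> C) : b 0%N = 1 ->
    (forall r, r.+1%:R * b r.+1 = - (c * d) * \sum_(i < r.+1) b i) ->
  forall k j v, annih c k (creat d j v) =
    \sum_(r < k.+1) b r *: creat_at d j r (annih c (k - r) v).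
Proof.
move=> b0 bS k j v; elim/ltn_ind: k => -[|k] IHk.
  by rewrite big_ord1 b0 scale1r creat_at0 !annih0.
have nz : k.+1%:R != 0 :> C by rewrite pnatr_eq0.
apply: (scalerI nz); rewrite annih_rec.
pose F i r := b r *: creat_at d j r (a i.+1%:Z (annih c (k - (i + r)) v)).
pose G s := creat_at d j s.+1 (annih c (k - s) v).
have -> : \sum_(i < k.+1) a i.+1%:Z (annih c (k - i) (creat d j v)) =
    \sum_(i < k.+1) \sum_(r < (k - i).+1) F i r
    + \sum_(i < k.+1) \sum_(r < (k - i).+1) (b r * d) *: G (i + r)%N.
  rewrite -big_split /=; apply: eq_bigr => i _.
  rewrite IHk ?ltnS ?leq_subr // linear_sum -big_split /=.
  apply: eq_bigr => r _; rewrite linearZ /= a_lower_creat_at scalerDr scalerA.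
  by rewrite /F /G subnDA addnS [(r + i)%N]addnC.
rewrite (triangle_sum_exchange k F).
rewrite (triangle_sum_diag k (fun i r => (b r * d) *: G (i + r)%N)) scalerDr.
(* Split the factor [k + 1] as [(k + 1 - r) + r]: the first part comes from the
   recursion of [annih c], the second from the recursion of [b]. *)
have -> : k.+1%:R *: (\sum_(r < k.+2) b r *: creat_at d j r (annih c (k.+1 - r) v))
  = \sum_(r < k.+2) (b r * (k.+1 - r)%:R) *: creat_at d j r (annih c (k.+1 - r) v)
  + \sum_(r < k.+2) (r%:R * b r) *: creat_at d j r (annih c (k.+1 - r) v).
  rewrite -big_split scaler_sumr /=; apply: eq_bigr => r _.
  rewrite -scalerDl scalerA mulrC [r%:R * _]mulrC -mulrDr -natrD subnK //.
  by rewrite -ltnS.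
rewrite [X in _ = X + _]big_ord_recr /= subnn mulr0 scale0r addr0.
rewrite [X in _ = _ + X]big_ord_recl mul0r scale0r add0r !scaler_sumr.
apply: (f_equal2 (fun x y => x + y)); apply: eq_bigr => r _.
  have le_rk : (r <= k)%N by rewrite -ltnS.
  have step : (k - r).+1%:R *: creat_at d j r (annih c (k - r).+1 v) =
      creat_at d j r (- c *: \sum_(i < (k - r).+1) a i.+1%:Z (annih c (k - r - i) v)).
    by rewrite -annih_rec linearZ.
  rewrite subSn // -scalerA step linearZ /=.
  rewrite [RHS]scalerA mulrC -scalerA; congr (_ *: _).
  rewrite linear_sum scaler_sumr.
  by apply: eq_bigr => i _; rewrite /F addnC subnDA.
rewrite /= /bump add1n subSS bS mulr_sumr scaler_suml scaler_sumr.
apply: eq_bigr => i _; rewrite scalerA subnK; last by rewrite -ltnS.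
by rewrite mulNr [b i * d]mulrC mulrA !mulNr.
Qed.

End Exchange.

(** * Linear spans and the states H_(j_1) ... H_(j_k) |m sqrt 2> *)

Section Span.
Variables (C : comNzRingType) (V : lmodType C).
Implicit Types (P Q : V -> Prop) (u v : V).

Inductive span P : V -> Prop :=
| span_zero : span P 0
| span_step c u v : P u -> span P v -> span P (c *: u + v).

Lemma span_add P u v : span P u -> span P v -> span P (u + v).
Proof.
move=> Pu Pv; elim: Pu => [|c w u' Pw _ IH]; first by rewrite add0r.
by rewrite -addrA; apply: span_step.
Qed.

Lemma span_scale P c u : span P u -> span P (c *: u).
Proof.
elim=> [|d w u' Pw _ IH]; first by rewrite scaler0; apply: span_zero.
by rewrite scalerDr scalerA; apply: span_step.
Qed.

Lemma span_gen P u : P u -> span P u.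
Proof.
by move=> Pu; rewrite -[u]addr0 -[u]scale1r; apply: span_step => //; apply: span_zero.
Qed.

Lemma span_sum P (I : Type) (r : seq I) (A : pred I) (F : I -> V) :
  (forall i, A i -> span P (F i)) -> span P (\sum_(i <- r | A i) F i).
Proof. by apply: big_ind; [exact: span_zero | exact: span_add]. Qed.

Lemma span_linear P Q (T : {linear V -> V}) :
  (forall u, P u -> span Q (T u)) -> forall u, span P u -> span Q (T u).
Proof.
move=> TPQ u; elim=> [|c w u' Pw _ IH]; first by rewrite linear0; apply: span_zero.
by rewrite linearP; apply: span_add => //; apply/span_scale/TPQ.
Qed.

Lemma span_sub P Q : (forall u, P u -> span Q u) -> forall u, span P u -> span Q u.
Proof.
move=> PQ u; elim=> [|c w u' Pw _ IH]; first exact: span_zero.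
by apply: span_add => //; apply/span_scale/PQ.
Qed.

End Span.

Section States.
Variable C : numClosedFieldType.
Implicit Types (v w : fock C) (s : seq nat) (m : int).

(** The letter recalls the complete homogeneous symmetric functions, which the [H_j]
    become when [sqrt 2 a_(-n)] is read as the power sum [p_n]. *)
Definition hstate s m : fock C := foldr (creat (sqrtC 2)) (ket C m) s.

Lemma hstate_cat_cons s t j m :
  hstate (s ++ j :: t) m = creat (sqrtC 2) j (hstate (s ++ t) m).
Proof. by elim: s => //= i s ->; rewrite creatC. Qed.

Lemma hstate_perm s t m : perm_eq s t -> hstate s m = hstate t m.
Proof.
elim: s t => [|j s IHs] t; first by rewrite perm_sym => /perm_nilP ->.
move=> pst; have j_t : j \in t by rewrite -(perm_mem pst) mem_head.
case/splitPr: j_t pst => t1 t2.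
rewrite perm_sym -cat1s perm_catCA /= perm_cons perm_sym => pst.
by rewrite hstate_cat_cons -(IHs _ pst).
Qed.

Lemma graded_hstate s m : graded m (sumn s) (hstate s m).
Proof.
elim: s => [|j s IHs] /=; first exact: graded_ket.
by rewrite addnC; apply: graded_creat.
Qed.

Lemma sector_hstate s m n :
  sector n (hstate s m) = if m == n then hstate s m else 0.
Proof.
elim: s => [|j s IHs] /=; first exact: sector_ket.
by rewrite sector_creat IHs; case: ifP => // _; rewrite linear0.
Qed.

Lemma expq_hstate s m n : expq n (hstate s m) = hstate s (m + n).
Proof.
elim: s => [|j s IHs] /=; first exact: expq_ket.
by rewrite expq_creat IHs.
Qed.

Lemma annih_ket c k m : annih c k.+1 (ket C m) = 0.
Proof.
elim/ltn_ind: k => k IHk.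
have nz : k.+1%:R != 0 :> C by rewrite pnatr_eq0.
apply: (scalerI nz); rewrite annih_rec scaler0 big1 ?scaler0 // => i _.
case def_n : (k - i)%N => [|n]; first by rewrite annih0 a_lower_ket.
rewrite IHk ?linear0 // -ltnS -def_n ltnS leq_subr //.
Qed.

(** Here [c d = 2] and the series [b] is [(1 - x)^2]. *)
Lemma annih_sqrt2_creat k j v : annih (sqrtC 2) k (creat (sqrtC 2) j v) =
  \sum_(r < k.+1) (nth 0 [:: 1; -2; 1] r) *:
     creat_at (sqrtC 2) j r (annih (sqrtC 2) (k - r) v).
Proof.
apply: annih_creat => // r; rewrite -expr2 sqrtCK.
case: r => [|[|r]]; first by rewrite big_ord1 mulr1 mul1r.
  by rewrite big_ord_recl big_ord1 /=; ring.
rewrite !big_ord_recl /= big1 => [|i _]; last by rewrite nth_nil.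
by rewrite nth_nil; ring.
Qed.

(** Here [c d = 1] and the series [b] is [1 - x]. *)
Lemma annih_invsqrt2_creat k j v :
  annih (sqrtC 2)^-1 k.+1 (creat (sqrtC 2) j v) =
  creat (sqrtC 2) j (annih (sqrtC 2)^-1 k.+1 v)
  - creat_at (sqrtC 2) j 1 (annih (sqrtC 2)^-1 k v).
Proof.
rewrite (@annih_creat _ _ _ (nth 0 [:: 1; -1])) //; last first.
  move=> r; rewrite mulVf ?sqrtC_eq0 ?pnatr_eq0 //.
  case: r => [|r]; first by rewrite big_ord1 mulr1 mul1r.
  rewrite !big_ord_recl /= big1 => [|i _]; last by rewrite nth_nil.
  by rewrite nth_nil; ring.
rewrite !big_ord_recl big1 => [|i _]; last by rewrite /= nth_nil scale0r.
by rewrite /= scale1r creat_at0 !subn0 addr0 scaleN1r subSS subn0.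
Qed.

(** Each factor loses at most [2] from its index, and [k] is lost in total. *)
Lemma annih_hstate k s m :
  span (fun u => exists s', [/\ size s' = size s, (sumn s' + k = sumn s)%N
                              & u = hstate s' m])
    (annih (sqrtC 2) k (hstate s m)).
Proof.
elim: s k => [|j s IHs] k.
  case: k => [|k]; last by rewrite annih_ket; apply: span_zero.
  by rewrite annih0; apply: span_gen; exists [::].
rewrite [hstate _ _]/= annih_sqrt2_creat; apply: span_sum => r _.
apply: span_scale; have le_rk : (r <= k)%N by rewrite -ltnS.
rewrite /creat_at; case: ifP => [le_rj|_]; last exact: span_zero.
apply: span_linear (IHs (k - r)%N) => u [s' [sz_s' sum_s' ->]].
apply: span_gen; exists ((j - r)%N :: s'); split=> //=; first by rewrite sz_s'.
by rewrite -sum_s'; lia.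
Qed.

Lemma annih_hstate_large k s m : (sumn s < k)%N ->
  annih (sqrtC 2) k (hstate s m) = 0.
Proof.
move=> lt_k; have := annih_hstate k s m; case=> // c u v [s' [_ sum_s' _]].
by move: lt_k; rewrite -sum_s' ltnNge leq_addl.
Qed.

Lemma annih_invsqrt2_large k s m : (size s < k)%N ->
  annih (sqrtC 2)^-1 k (hstate s m) = 0.
Proof.
elim: s k => [|j s IHs] [//|k] ltk; first by rewrite annih_ket.
rewrite [hstate _ _]/= annih_invsqrt2_creat !IHs ?linear0 ?subr0 //.
  by rewrite addr0.
exact: leqW.
Qed.

(** Only the term lowering every index by one has order [size s], and it vanishes as
    soon as one index is [0]. *)
Lemma annih_invsqrt2_top s m : annih (sqrtC 2)^-1 (size s) (hstate s m) =
  if 0%N \in s then 0 else (-1) ^+ size s *: hstate (map predn s) m.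
Proof.
elim: s => [|j s IHs]; first by rewrite annih0 scale1r.
rewrite [hstate _ _]/= annih_invsqrt2_creat annih_invsqrt2_large // linear0.
rewrite add0r IHs inE eq_sym; case: ifP => _; first by rewrite orbT linear0 oppr0.
rewrite orbF /creat_at; case: j => [|j] /=; first by rewrite oppr0.
by rewrite linearZ subSS subn0 exprS mulN1r scaleNr.
Qed.

End States.

(** * The charge n part of the basic subspace *)

Section BasicSubspace.
Variable C : numClosedFieldType.
Implicit Types (u v w : fock C) (s : seq nat) (N m : int).
Implicit Types (x : nat * int * nat) (r : seq (nat * int * nat)).

Lemma sector_annih m c k v : sector m (annih c k v) = annih c k (sector m v).
Proof.
apply: (opseries_exp_commute (A := lowering c)) => -[|i] w.
  by rewrite /= lowering0 [RHS]lowering0 linear0.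
by rewrite /= loweringS [RHS]loweringS linearZ /= sector_a.
Qed.

Definition vterm x v : fock C :=
  creat (sqrtC 2) x.1.1 (expq 1 (sector x.1.2 (annih (sqrtC 2) x.2 v))).

Lemma vterm_linear x : linear (vterm x).
Proof. by move=> c u v; rewrite /vterm !linearP. Qed.
HB.instance Definition _ x := GRing.isLinear.Build C (fock C) (fock C) *:%R
  (vterm x) (vterm_linear x).

Definition vweight x : int := x.1.1%:Z + 2 * 1 * x.1.2 - x.2%:Z.

(** A finite list of index triples outside of which no term of the vertex sum acts
    on [v]. A sum with infinite support is [0] by convention, so
    additivity of the vertex sum requires such a list. *)
Definition vsupport N v r :=
  [/\ uniq r, forall x, x \in r -> vweight x = N
    & forall x, vweight x = N -> x \notin r -> vterm x v = 0].

Lemma vertexE N v r : vsupport N v r -> vertex 1 N v = \sum_(x <- r) vterm x v.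
Proof.
move=> [uniq_r rN r0]; rewrite /vertex (fsbigE r) //; last first.
rewrite [LHS]big_seq_cond [RHS]big_seq; apply: eq_bigl => x.
by case: (boolP (x \in r)) => //= /rN xN; apply: mem_set.
Qed.

(** Two vectors and their combination share one finite set of indices, so their
    vertex sums can be added term by term. *)
Lemma vsupport_linear N c u v ru rv : vsupport N u ru -> vsupport N v rv ->
  exists r, [/\ vsupport N u r, vsupport N v r & vsupport N (c *: u + v) r].
Proof.
move=> [_ uN u0] [_ vN v0]; exists (undup (ru ++ rv)).
have rN x : x \in undup (ru ++ rv) -> vweight x = N.
  by rewrite mem_undup mem_cat => /orP[/uN|/vN].
have out x : vweight x = N -> x \notin undup (ru ++ rv) ->
    vterm x u = 0 /\ vterm x v = 0.
  move=> xN; rewrite mem_undup mem_cat negb_or => /andP[xu xv].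
  by rewrite u0 ?v0.
have uniq_r := undup_uniq (ru ++ rv).
split; split; [exact: uniq_r | exact: rN | | exact: uniq_r | exact: rN |
  | exact: uniq_r | exact: rN | ] => x xN /(out x xN)[xu xv].
- exact: xu.
- exact: xv.
by rewrite linearP /= xu xv scaler0 addr0.
Qed.

Lemma vertex_linear N c u v ru rv : vsupport N u ru -> vsupport N v rv ->
  vertex 1 N (c *: u + v) = c *: vertex 1 N u + vertex 1 N v.
Proof.
move=> su sv; have [r [ru' rv' ruv]] := vsupport_linear c su sv.
rewrite (vertexE ru') (vertexE rv') (vertexE ruv) scaler_sumr -big_split /=.
by apply: eq_bigr => x _; rewrite linearP.
Qed.

Definition vindices N m s : seq (nat * int * nat) :=
  [seq (`|(N - 2 * m + k%:Z)%R|%N, m, k) |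
     k <- iota 0 (sumn s).+1 & (0 <= N - 2 * m + k%:Z)].

(** The sector must be [m], the annihilation index is at most the total index, and
    the weight then determines the creation index. *)
Lemma vsupport_hstate N m s : vsupport N (hstate C s m) (vindices N m s).
Proof.
split=> [|x|[[j n] k]].
- rewrite map_inj_uniq; last by move=> k l [_].
  by rewrite filter_uniq ?iota_uniq.
- case/mapP => k; rewrite mem_filter => /andP[ge0 _] ->.
  by rewrite /vweight /= gez0_abs //; lia.
rewrite /vweight /vterm /= => jN; apply: contraNeq.
rewrite sector_annih sector_hstate; case: (eqVneq m n) => [def_m|_]; last first.
  by rewrite !linear0 eqxx.
case: (leqP k (sumn s)) => [le_k _|lt_k]; last first.
  by rewrite annih_hstate_large // !linear0 eqxx.
have def_j : N - 2 * m + k%:Z = j%:Z by rewrite -jN def_m; lia.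
apply/mapP; exists k; last by rewrite def_j def_m.
by rewrite mem_filter def_j mem_iota /= add0n ltnS.
Qed.

Definition state u := exists s m, u = hstate C s m.
Definition charged (n : nat) u := exists2 s, size s = n & u = hstate C s n%:Z.

Lemma charged_state n u : span (charged n) u -> span state u.
Proof.
by apply: span_sub => {}u [s _ ->]; apply: span_gen; exists s, n%:Z.
Qed.

Lemma vsupport_span N u : span state u -> exists r, vsupport N u r.
Proof.
elim=> [|c v w [s [m ->]] _ [r sr]].
  by exists [::]; split=> // x _ _; rewrite linear0.
have [r' [_ _ sr']] := vsupport_linear c (vsupport_hstate N m s) sr.
by exists r'.
Qed.

Lemma e_linear n c u v : span state u -> span state v ->
  e n (c *: u + v) = c *: e n u + e n v.
Proof.
rewrite /e => su sv; have [ru hu] := vsupport_span (- n - 1) su.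
have [rv hv] := vsupport_span (- n - 1) sv.
exact: vertex_linear hu hv.
Qed.

Lemma e0 n : e n 0 = 0 :> fock C.
Proof.
rewrite /e (@vertexE _ _ [::]) ?big_nil //.
by split=> // x _ _; rewrite linear0.
Qed.

Lemma e_hstate i s (n : nat) : e (- i.+1%:Z) (hstate C s n%:Z) =
  \sum_(k <- iota 0 (sumn s).+1 | 0 <= i%:Z - 2 * n%:Z + k%:Z)
    creat (sqrtC 2) `|(i%:Z - 2 * n%:Z + k%:Z)%R|%N
      (expq 1 (annih (sqrtC 2) k (hstate C s n%:Z))).
Proof.
rewrite /e (_ : - (- i.+1%:Z) - 1 = i%:Z); last by lia.
rewrite (vertexE (vsupport_hstate _ _ _)) big_map big_filter.
apply: eq_bigr => k _.
by rewrite /vterm /= sector_annih sector_hstate eqxx.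
Qed.

(** The operator [e_(-i-1)] adds exactly one factor [H_j]. *)
Lemma e_charged i n u : span (charged n) u ->
  span (charged n.+1) (e (- i.+1%:Z) u).
Proof.
elim=> [|c v w [s sz_s ->] sw IHw]; first by rewrite e0; apply: span_zero.
rewrite e_linear; [|by apply: span_gen; exists s, n%:Z|exact: charged_state sw].
apply: span_add => //; apply: span_scale; rewrite e_hstate.
apply: span_sum => k _.
pose T : {linear fock C -> fock C} :=
  creat (sqrtC 2) `|(i%:Z - 2 * n%:Z + k%:Z)%R|%N \o expq 1.
apply: (@span_linear _ _ _ _ T _ _ (annih_hstate C k s n%:Z)) => u' [s' [sz_s' _ ->]].
apply: span_gen; exists (`|(i%:Z - 2 * n%:Z + k%:Z)%R|%N :: s').
  by rewrite /= sz_s' sz_s.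
by rewrite /T /= expq_hstate (_ : n.+1%:Z = n%:Z + 1) //; lia.
Qed.

Definition e_monomial (l : seq nat) : fock C :=
  foldr (fun i w => e (- i.+1%:Z) w) (ket C 0) l.

Lemma e_monomial_charged l : span (charged (size l)) (e_monomial l).
Proof.
elim: l => [|i l IHl] /=; last exact: e_charged.
by apply: span_gen; exists [::].
Qed.

Lemma W0_zero : W0 C 0.
Proof. by exists [::]; rewrite big_nil. Qed.

Lemma W0_add u v : W0 C u -> W0 C v -> W0 C (u + v).
Proof. by move=> [s ->] [t ->]; exists (s ++ t); rewrite big_cat. Qed.

Lemma W0_scale c u : W0 C u -> W0 C (c *: u).
Proof.
move=> [s ->]; exists [seq (c * y.1, y.2) | y <- s].
by rewrite big_map scaler_sumr; apply: eq_bigr => y _; rewrite scalerA.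
Qed.

Lemma W0_sum (I : Type) (r : seq I) (A : pred I) (F : I -> fock C) :
  (forall i, A i -> W0 C (F i)) -> W0 C (\sum_(i <- r | A i) F i).
Proof. by apply: big_ind; [exact: W0_zero | exact: W0_add]. Qed.

Lemma W0_span (P : fock C -> Prop) u : (forall v, P v -> W0 C v) ->
  span P u -> W0 C u.
Proof.
move=> PW; elim=> [|c v w /PW Wv _ Ww]; first exact: W0_zero.
by apply: W0_add => //; apply: W0_scale.
Qed.

Lemma W0_e_monomial l : W0 C (e_monomial l).
Proof. by exists [:: (1, l)]; rewrite big_seq1 scale1r. Qed.

Lemma W0_e i u : W0 C u -> W0 C (e (- i.+1%:Z) u).
Proof.
move=> [s ->].
suff [] : span state (\sum_(y <- s) y.1 *: e_monomial y.2) /\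
  W0 C (e (- i.+1%:Z) (\sum_(y <- s) y.1 *: e_monomial y.2)) by [].
elim: s => [|y s [IHs1 IHs2]].
  by rewrite big_nil e0; split; [exact: span_zero | exact: W0_zero].
have sy := charged_state (e_monomial_charged y.2).
rewrite big_cons; split; first by apply: span_add => //; apply: span_scale.
rewrite e_linear //; apply: W0_add => //; apply: W0_scale.
exact: (W0_e_monomial (i :: y.2)).
Qed.

(** In [e_(-(j + 2n)-1) (H_s |n sqrt 2>)] the term without annihilation is the
    state wanted; all the others have a head of larger index and a tail of smaller
    total index, and are covered by the inner induction on the latter. *)
Lemma W0_hstate n s : size s = n -> W0 C (hstate C s n%:Z).
Proof.
elim: n s => [|n IHn] [|j s] //; first by move=> _; apply: (W0_e_monomial [::]).
case=> sz_s; have [d] := ubnP (sumn s); elim: d => // d IHd in j s sz_s *.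
rewrite ltnS => le_d.
(* The mode is chosen so that the creation index is [j] when [k = 0]. *)
have := W0_e (j + 2 * n) (IHn s sz_s); rewrite e_hstate.
have idx k : (j + 2 * n)%N%:Z - 2 * n%:Z + k%:Z = (j + k)%N%:Z by lia.
under eq_bigl => k do rewrite idx.
under eq_bigr => k _ do rewrite idx absz_nat.
rewrite big_cons /= addn0 annih0 expq_hstate (_ : n%:Z + 1 = n.+1%:Z); last by lia.
set R := \sum_(_ <- _ | _) _ => We.
suff WR : W0 C R.
  have := W0_add We (W0_scale (-1) WR).
  by rewrite scaleN1r addrK.
rewrite /R big_seq_cond; apply: W0_sum => k /andP[]; rewrite mem_iota => /andP[k_gt0 _] _.
pose T : {linear fock C -> fock C} := creat (sqrtC 2) (j + k) \o expq 1.
pose P u := exists s', [/\ size s' = n, (sumn s' + k = sumn s)%N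
  & u = T (hstate C s' n%:Z)].
apply: (@W0_span P) => [_ [s' [sz_s' sum_s' ->]]|].
  rewrite /T /= expq_hstate (_ : n%:Z + 1 = n.+1%:Z); last by lia.
  by apply: (IHd (j + k)%N s') => //; lia.
apply: (@span_linear _ _ _ _ T _ _ (annih_hstate C k s n%:Z)) => u.
move=> [s' [sz_s' sum_s' ->]]; apply: span_gen; exists s'.
by rewrite sz_s' sz_s.
Qed.

End BasicSubspace.

(** * Counting partitions and the basis of states *)

Section Counting.

Definition qpoch_inv n : nat -> int := fps_inv (fps_of_poly (qpoch n)).

Lemma qpochS n : qpoch n.+1 = qpoch n * (1 - 'X^(n.+1)).
Proof. by rewrite /qpoch big_nat_recr. Qed.

Lemma qpoch_coef0 n : (qpoch n)`_0 = 1.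
Proof.
elim: n => [|n IHn]; first by rewrite /qpoch big_geq // coef1.
by rewrite qpochS coef0M IHn coefB coef1 coefXn subr0 mul1r.
Qed.

Lemma qpoch_invP n N d : (d < N)%N ->
  (qpoch n * \poly_(i < N) qpoch_inv n i)`_d = (d == 0%N)%:R.
Proof.
move=> lt_d; rewrite -(@fps_mulV _ (fps_of_poly (qpoch n))); last first.
  by rewrite /fps_of_poly qpoch_coef0 unitr1.
rewrite coefM; apply: eq_bigr => i _; rewrite coef_poly ifT //.
by apply: leq_ltn_trans lt_d; rewrite leq_subr.
Qed.

(** A series with constant term [1] can be cancelled, also modulo ['X^N]. *)
Lemma coef_mul_inj (p r : {poly int}) N : p`_0 = 1 ->
  (forall d, (d < N)%N -> (p * r)`_d = 0) -> forall d, (d < N)%N -> r`_d = 0.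
Proof.
move=> p0 pr0; elim/ltn_ind => d IHd lt_d.
have := pr0 d lt_d; rewrite coefM big_ord_recl p0 mul1r subn0 big1 ?addr0 //.
move=> i _; have lt_i := ltn_ord i; rewrite IHd ?mulr0 //=.
  by rewrite /bump; lia.
by apply: leq_ltn_trans lt_d; rewrite leq_subr.
Qed.

Lemma qpoch_inv0 d : qpoch_inv 0 d = (d == 0%N)%:R.
Proof.
have := @qpoch_invP 0 d.+1 d (leqnn _); rewrite /qpoch big_geq // mul1r.
by rewrite coef_poly leqnn.
Qed.

(** From [(1 - q^(n+1)) / (q)_(n+1) = 1 / (q)_n]: a partition with at most [n + 1]
    parts has at most [n] of them, or is obtained by adding [1] to [n + 1] parts. *)
Lemma qpoch_invS n d : qpoch_inv n.+1 d =
  qpoch_inv n d + (if (n < d)%N then qpoch_inv n.+1 (d - n.+1) else 0).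
Proof.
pose g m : {poly int} := \poly_(i < d.+1) qpoch_inv m i.
have := @coef_mul_inj (qpoch n) ((1 - 'X^(n.+1)) * g n.+1 - g n) d.+1
  (qpoch_coef0 n) _ d (leqnn _).
rewrite mulrBl mul1r !coefB coefXnM !coef_poly leqnn.
rewrite (_ : (d - n.+1 < d.+1)%N = true) => [H|]; last by rewrite ltnS leq_subr.
have -> : (if (n < d)%N then qpoch_inv n.+1 (d - n.+1) else 0) =
    if (d < n.+1)%N then 0 else qpoch_inv n.+1 (d - n.+1).
  by rewrite ltnS; case: leqP.
apply/eqP; rewrite -subr_eq0 opprD addrA addrAC; apply/eqP/H => k lt_k.

by rewrite -{1}[g n.+1]mul1r -mulrBl mulrBr mulrA -qpochS coefB !qpoch_invP // subrr.
Qed.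

Lemma character_coef n d :
  fps_mul (fps_of_poly ('X^(n ^ 2))%R) (fps_inv (fps_of_poly (qpoch n))) d =
  if (n ^ 2 <= d)%N then qpoch_inv n (d - n ^ 2) else 0.
Proof.
rewrite /fps_mul /fps_of_poly; case: leqP => [le_d|lt_d].
  rewrite (bigD1 (Ordinal (le_d : n ^ 2 < d.+1)%N)) //= coefXn eqxx mul1r.
  rewrite big1 ?addr0 // => i ne_i.
  have ne_in : (i == n ^ 2 :> nat)%N = false by exact: negPf ne_i.
  by rewrite coefXn ne_in mul0r.
rewrite big1 // => i _; rewrite coefXn ltn_eqF ?mul0r //.
by apply: leq_ltn_trans lt_d; rewrite -ltnS.
Qed.

End Counting.

Section Basis.
Variable C : numClosedFieldType.

Definition independent (B : seq (seq nat)) := forall m (c : seq nat -> C),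
  \sum_(s <- B) c s *: hstate C s m = 0 -> forall s, s \in B -> c s = 0.

(** Partitions of [d] with at most [n] parts, padded with zeros to length [n]. For
    [n + 1] the list consists of those with a part [0] prepended and of those with
    all [n + 1] parts raised by one. The operator [annih (1 / sqrt 2)] of index
    [n + 1] separates the two kinds: it kills the first and inverts the raising,
    up to sign, on the second. *)
Lemma partition_basis n d : exists B : seq (seq nat),
  [/\ (size B)%:Z = qpoch_inv n d, uniq B,
      forall s, s \in B -> size s = n /\ sumn s = d,
      forall s, size s = n -> sumn s = d -> exists2 t, t \in B & perm_eq s t
    & independent B].
Proof.
elim: n d => [|n IHn] d.
  case: d => [|d].
    exists [:: [::]]; split=> //; first by rewrite qpoch_inv0.
    - by move=> s; rewrite inE => /eqP ->.
    - by move=> s /size0nil -> _; exists [::].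
    move=> m c; rewrite big_seq1 => c0 s; rewrite inE => /eqP ->.
    have := congr1 (mcoeff ((m, mone) : fock_basis)) c0.
    by rewrite mcoeffZ mcoeffUU mulr1 mcoeff0.
  exists [::]; split=> //; first by rewrite qpoch_inv0.
  by move=> s /size0nil ->.
elim/ltn_ind: d => d IHd; have [B1 [sz1 uniq1 B1P B1cov ind1]] := IHn d.
have [B2 [sz2 uniq2 B2P B2cov ind2]] : exists B2 : seq (seq nat), [/\
    (size B2)%:Z = if (n < d)%N then qpoch_inv n.+1 (d - n.+1) else 0,
    uniq B2,
    forall s, s \in B2 -> size s = n.+1 /\ (sumn s + n.+1)%N = d,
    forall s, size s = n.+1 -> (sumn s + n.+1)%N = d ->
      exists2 t, t \in B2 & perm_eq s t
  & independent B2].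
  case: ltnP => [lt_nd|le_dn]; last first.
    by exists [::]; split=> // s _; lia.
  have [|B2 [? ? B2P B2cov ?]] := IHd (d - n.+1)%N; first by lia.
  exists B2; split=> // s.
    by move=> /B2P[-> ->]; split=> //; lia.
  by move=> sz_s sum_s; apply: B2cov => //; lia.
pose F s := map S s.
have predF s : map predn (F s) = s by rewrite -map_comp map_id_in.
have F_inj : injective F := can_inj predF.
have F0 s : 0%N \notin F s by apply/mapP => -[].
have sumF s : sumn (F s) = (sumn s + size s)%N.
  by elim: s => //= j s ->; rewrite addSn addnS addnA.
exists (map (cons 0%N) B1 ++ map F B2); split.
- by rewrite size_cat !size_map PoszD sz1 sz2 [RHS]qpoch_invS.
- rewrite cat_uniq !map_inj_uniq // ?uniq1 ?uniq2 ?andbT /=; last by move=> s t [].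
  by apply/hasPn => _ /mapP[s _ ->]; apply: contraNN (F0 s) => /mapP[t _ ->]; apply: mem_head.
- move=> s; rewrite mem_cat => /orP[] /mapP[t].
    by move=> /B1P[<- <-] ->.
  by move=> /B2P[sz_t sum_t] ->; rewrite size_map sumF sz_t.
- move=> s sz_s sum_s; case: (boolP (0%N \in s)) => s0.
    have ps := perm_to_rem s0.
    have [||t tB pt] := B1cov (rem 0%N s).
    + by rewrite size_rem // sz_s.
    + by rewrite -sum_s (perm_sumn ps).
    exists (0%N :: t); first by rewrite mem_cat map_f.
    by apply: perm_trans ps _; rewrite perm_cons.
  have def_s : s = F (map predn s).
    rewrite /F -map_comp map_id_in // => j js /=.
    by rewrite prednK // lt0n; apply: contraNneq s0 => <-.
  have [||t tB pt] := B2cov (map predn s).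
  + by rewrite size_map.
  + by rewrite -sum_s [in RHS]def_s sumF size_map sz_s.
  exists (F t); first by rewrite mem_cat map_f ?orbT.
  by rewrite def_s; apply: perm_map.
move=> m c; rewrite big_cat !big_map /= => c0.
(* A relation between all states gives one between those in [F B2], which
   [annih] of index [n + 1] carries to a relation between the states in [B2]. *)
have c2 s : s \in B2 -> c (F s) = 0.
  apply: (ind2 m (fun s => c (F s))).
  have := congr1 (annih (sqrtC 2)^-1 n.+1) c0.
  rewrite linearD !linear_sum linear0 /= big_seq big1 ?add0r; last first.
    move=> t /B1P[sz_t _]; rewrite linearZ /= creat0 annih_invsqrt2_large ?scaler0 //.
    by rewrite sz_t.
  move=> c0'; have sg : (-1) ^+ n.+1 != 0 :> C by rewrite signr_eq0.
  apply: (scalerI sg); rewrite scaler0 -[RHS]c0' scaler_sumr.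
  rewrite big_seq [RHS]big_seq; apply: eq_bigr => t /B2P[sz_t _].
  have top : annih (sqrtC 2)^-1 n.+1 (hstate C (F t) m) =
      (-1) ^+ n.+1 *: hstate C t m.
    have := annih_invsqrt2_top C (F t) m.
    by rewrite (negPf (F0 t)) predF size_map sz_t.
  rewrite [RHS]linearZ /= top.
  by rewrite !scalerA mulrC.
rewrite [X in _ + X]big_seq [X in _ + X]big1 ?addr0 in c0; last first.
  by move=> s /c2 ->; rewrite scale0r.
move=> s; rewrite mem_cat => /orP[] /mapP[t tB ->]; last exact: c2.
apply: (ind1 m (fun s => c (0%N :: s))) => //.
by rewrite -[RHS]c0; apply: eq_bigr => s' _; rewrite /= creat0.
Qed.

End Basis.

(** * The character *)

Section Character.
Variable C : numClosedFieldType.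
Implicit Types (u v w : fock C) (s : seq nat).

Lemma half_h0_graded (n : nat) d v :
  graded n%:Z d v -> half_h0 C v = n%:R *: v.
Proof.
move=> gv; apply/malgP => b; rewrite half_h0_mcoeff mcoeffZ.
by case: (eqVneq v@_b 0) => [->|/gv[-> _] //]; rewrite !mulr0.
Qed.

Lemma L0_graded (n : nat) d v :
  graded n%:Z d v -> L0 C v = (n ^ 2 + d)%:R *: v.
Proof.
move=> gv; apply/malgP => b; rewrite L0_mcoeff mcoeffZ.
case: (eqVneq v@_b 0) => [->|/gv[-> ->]]; first by rewrite !mulr0.
by rewrite natrD natrX.
Qed.

Lemma hstate_weight n s : size s = n ->
  weight_space (W0 C) (half_h0 C) (L0 C) n (n ^ 2 + sumn s) (hstate C s n%:Z).
Proof.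
move=> sz_s; have gs := @graded_hstate C s n%:Z; split.
- exact: W0_hstate.
- exact: half_h0_graded gs.
- exact: L0_graded gs.
Qed.

Lemma weight_spaceZ n d c v :
  weight_space (W0 C) (half_h0 C) (L0 C) n d v ->
  weight_space (W0 C) (half_h0 C) (L0 C) n d (c *: v).
Proof.
case=> Wv hv Lv; split; first exact: W0_scale.
  apply/malgP => b; have := half_h0_mcoeff v b.
  rewrite hv mcoeffZ => vb; rewrite half_h0_mcoeff [RHS]mcoeffZ !mcoeffZ.
  by rewrite mulrCA -vb mulrCA.
apply/malgP => b; have := L0_mcoeff v b.
rewrite Lv mcoeffZ => vb; rewrite L0_mcoeff [RHS]mcoeffZ !mcoeffZ.
by rewrite mulrCA -vb mulrCA.
Qed.

Lemma W0_charged v : W0 C v -> span (fun u => exists n, charged n u) v.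
Proof.
move=> [s ->]; apply: span_sum => y _; apply: span_scale.
apply: span_sub (e_monomial_charged C y.2) => u cu.
by apply: span_gen; exists (size y.2).
Qed.

Definition weight_basis n d u :=
  exists s, [/\ size s = n, (n ^ 2 + sumn s)%N = d & u = hstate C s n%:Z].

(** Since states are homogeneous, discarding from a combination those of the wrong
    weight is the same as discarding the monomials of the wrong weight. *)
Lemma weight_component n d v : span (fun u => exists n, charged n u) v ->
  exists2 w, span (weight_basis n d) w & forall b : fock_basis, w@_b =
    if (b.1 == n%:Z) && (n ^ 2 + level b.2 == d)%N then v@_b else 0.
Proof.
elim=> [|c u v' [m [s sz_s ->]] _ [w sw wE]].
  by exists 0 => [|b]; [exact: span_zero | rewrite mcoeff0 if_same].
have gs := @graded_hstate C s m%:Z.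
case: (boolP ((m == n) && (n ^ 2 + sumn s == d)%N)) => [/andP[/eqP mn /eqP sd]|ne].
  exists (c *: hstate C s m%:Z + w).
    by apply: span_step => //; exists s; rewrite sz_s mn.
  move=> b; rewrite !mcoeffD !mcoeffZ wE.
  case: (eqVneq (hstate C s m%:Z)@_b 0) => [->|/gs[-> ->]].
    by rewrite mulr0 !add0r.
  by rewrite mn sd !eqxx.
exists w => // b; rewrite mcoeffD mcoeffZ wE; case: ifP => // bnd.
case: (eqVneq (hstate C s m%:Z)@_b 0) => [->|/gs[b1 b2]].
  by rewrite mulr0 add0r.
by move: bnd ne; rewrite b1 b2 eqz_nat => ->.
Qed.

(** Eigenvectors of the two diagonal operators only involve monomials of their own
    weight, so that they equal their component of that weight. *)
Lemma weight_space_span n d v :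
  weight_space (W0 C) (half_h0 C) (L0 C) n d v -> span (weight_basis n d) v.
Proof.
case=> Wv hv Lv; have [w sw wE] := weight_component n d (W0_charged Wv).
(* A monomial of [v] has weight [(n, d)], because [v] is an eigenvector. *)
suff -> : v = w by [].
apply/malgP => b; rewrite wE; case: ifPn => // nb.
apply/eqP; apply: contraNT nb => vb.
have := half_h0_mcoeff v b; rewrite hv mcoeffZ.
move/(mulIf vb)/esym; rewrite pmulrn => /intr_inj b1.
have := L0_mcoeff v b; rewrite Lv mcoeffZ.
move/(mulIf vb)/esym; rewrite b1 -natrX -natrD => /eqP; rewrite eqr_nat => ->.
by rewrite eqxx.
Qed.

Lemma W0_decomposition v : W0 C v -> exists2 s : seq (nat * nat * fock C),
  (forall x, x \in s ->
     weight_space (W0 C) (half_h0 C) (L0 C) x.1.1 x.1.2 x.2)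
  & v = \sum_(x <- s) x.2.
Proof.
move/W0_charged; elim=> [|c u w [n [s sz_s ->]] _ [r rP ->]].
  by exists [::]; rewrite ?big_nil.
exists ((n, (n ^ 2 + sumn s)%N, c *: hstate C s n%:Z) :: r).
  move=> x; rewrite inE => /orP[/eqP ->|/rP //].
  exact/weight_spaceZ/hstate_weight.
by rewrite big_cons.
Qed.

Lemma weight_space_dim n d : exists2 k,
  has_dim (weight_space (W0 C) (half_h0 C) (L0 C) n d) k
  & fps_mul (fps_of_poly ('X^(n ^ 2))%R) (fps_inv (fps_of_poly (qpoch n))) d
    = k%:Z.
Proof.
rewrite character_coef; case: leqP => [le_d|lt_d]; last first.
  exists 0%N => //; exists (fun _ => 0); split=> [[]//|c _ []//|v /weight_space_span].
  case=> [|c u w [s [_ sd _]]]; last by move: lt_d; rewrite -sd; lia.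
  by exists (fun _ => 0); rewrite big_ord0.
have [B [szB uniqB BP Bcov indB]] := partition_basis C n (d - n ^ 2).
exists (size B) => //.
exists (fun i => hstate C (nth [::] B i) n%:Z); split.
- move=> i; have [sz_i sum_i] := BP _ (mem_nth [::] (ltn_ord i)).
  by have := hstate_weight sz_i; rewrite sum_i subnKC.
- move=> c c0 i.
  pose c' s := oapp c 0 (insub (index s B)).
  have c'E (j : 'I_(size B)) : c' (nth [::] B j) = c j.
    by rewrite /c' index_uniq // valK.
  rewrite -c'E; apply: (indB n%:Z) (mem_nth _ (ltn_ord i)).
  rewrite (big_nth [::]) big_mkord -[RHS]c0; apply: eq_bigr => j _.
  by rewrite c'E.
move=> v /weight_space_span; elim=> [|c u w [s [sz_s sd ->]] _ [f ->]].
  by exists (fun _ => 0); rewrite big1 // => i _; rewrite scale0r.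
have [|t tB pst] := Bcov s sz_s; first by rewrite -sd addKn.
have lt_t : (index t B < size B)%N by rewrite index_mem.
exists (fun i => (if i == Ordinal lt_t then c else 0) + f i).
under [RHS]eq_bigr => i _ do rewrite scalerDl.
rewrite big_split /=; congr (_ + _); rewrite (bigD1 (Ordinal lt_t)) //= eqxx.
rewrite nth_index // -(hstate_perm _ _ pst) big1 ?addr0 // => i /negPf ->.
by rewrite scale0r.
Qed.

End Character.

Theorem mainTheorem3 (R : realType) :
  has_character (W0 R[i]) (half_h0 R[i]) (L0 R[i])
    (fun n : nat =>
       fps_mul (fps_of_poly ('X^(n ^ 2))%R) (fps_inv (fps_of_poly (qpoch n)))).
Proof.
split; [exact: W0_decomposition | exact: weight_space_dim].
Qed.
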